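(* Let $M$ be a smooth manifold, let $E\to M$ be an orientable real vector bundle of rank $k$ equipped with a Riemannian structure, and let $n\ge k$. Then there is a fiber-preserving strong deformation retraction of the $n$-frame bundle $\mathcal{F}^n(E)$ onto the $n$-Parseval bundle $\mathcal{P}^n(E)$. That is, writing $\pi:\mathcal{F}^n(E)\to M$ for the bundle projection, there is a continuous map $H:\mathcal{F}^n(E)\times[0,1]\to\mathcal{F}^n(E)$ such that $H(x,0)=x$ and $H(x,1)\in\mathcal{P}^n(E)$ for all $x\in\mathcal{F}^n(E)$, $H(y,t)=y$ for all $y\in\mathcal{P}^n(E)$ and $t\in[0,1]$, and $\pi(H(x,t))=\pi(x)$ for all $x$ and $t$.
   Context: A Riemannian structure on a real vector bundle $E\to M$ is a choice of inner product on each fiber $E_p$, varying smoothly in $p\in M$. For a $k$-dimensional real vector space $V$ and $n\ge k$, $\mathcal{F}^n(V)\subset\operatorname{Hom}(\mathbb{R}^n,V)$ is the space of surjective linear maps $\mathbb{R}^n\to V$ ($n$-frames in $V$). If $V$ has an inner product, $\mathcal{P}^n(V)\subset\mathcal{F}^n(V)$ is the subspace of $A$ with $AA^T=I_V$ (Parseval frames), where $A^T$ is the adjoint with respect to the standard inner product on $\mathbb{R}^n$ and the inner product on $V$. The $n$-frame bundle $\mathcal{F}^n(E)\to M$ (resp. the $n$-Parseval bundle $\mathcal{P}^n(E)\to M$) is the fiber subbundle of the vector bundle $\operatorname{Hom}(M\times\mathbb{R}^n,E)$ whose fiber over $p\in M$ is $\mathcal{F}^n(E_p)$ (resp. $\mathcal{P}^n(E_p)$);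 thus $\mathcal{P}^n(E)\subset\mathcal{F}^n(E)$. *)

(* Defs.v *)
From HB Require Import structures.
From mathcomp Require Import all_boot all_order all_algebra.
From mathcomp Require Import all_classical all_reals all_analysis.
Import Order.TTheory GRing.Theory Num.Theory.
Import numFieldNormedType.Exports.

Set Implicit Arguments.
Unset Strict Implicit.
Unset Printing Implicit Defensive.

Local Open Scope classical_set_scope.
Local Open Scope ring_scope.

(* f is C^j on the open set U of R^m: all its iterated partial derivatives of
   order at most j exist and are continuous on U.  The values of f outside of U
   are irrelevant. *)
Fixpoint Ck_on (R : realType) (m j : nat) (U : set 'rV[R]_m)
    (f : 'rV[R]_m -> R) : Prop :=
  {within U, continuous f} /\
  if j is j'.+1 then
    forall i : 'I_m,
      (forall x, U x -> derivable f x (delta_mx 0 i)) /\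
      Ck_on j' U ('D_(delta_mx 0 i) f)
  else True.

Definition smooth_on (R : realType) (m : nat) (U : set 'rV[R]_m)
    (f : 'rV[R]_m -> R) : Prop :=
  forall j, Ck_on j U f.

(* Homeomorphisms from an open subset of M onto an open subset of R^m;
   [chart_fun] is only meaningful on [chart_dom] and [chart_inv] on the image
   of [chart_dom]. *)
Record chart (R : realType) (M : topologicalType) (m : nat) := Chart {
  chart_dom : set M;
  chart_fun : M -> 'rV[R]_m;
  chart_inv : 'rV[R]_m -> M;
  chart_dom_open : open chart_dom;
  chart_img_open : open (chart_fun @` chart_dom);
  chart_funK : forall p, chart_dom p -> chart_inv (chart_fun p) = p;
  chart_fun_continuous : {within chart_dom, continuous chart_fun};
  chart_inv_continuous :
    {within chart_fun @` chart_dom, continuous chart_inv}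
}.

(* Smooth manifolds without boundary, of dimension m. *)
Record manifold (R : realType) (m : nat) := Manifold {
  mf_space :> topologicalType;
  mf_hausdorff : hausdorff_space mf_space;
  mf_second_countable : @second_countable mf_space;
  mf_atlas : set (chart R mf_space m);
  mf_atlas_cover : forall p, exists2 c, mf_atlas c & chart_dom c p;
  mf_atlas_smooth : forall c d, mf_atlas c -> mf_atlas d ->
    forall i : 'I_m,
      smooth_on (chart_fun c @` (chart_dom c `&` chart_dom d))
        (fun x => chart_fun d (chart_inv c x) 0 i)
}.

(* Smoothness of a real-valued function on an open subset U of a manifold. *)
Definition smooth_fun (R : realType) (m : nat) (M : manifold R m) (U : set M)
    (f : M -> R) : Prop :=
  forall c, mf_atlas c ->
    smooth_on (chart_fun c @` (chart_dom c `&` U)) (f \o chart_inv c).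

(* Families of vector spaces over M: a topological total space with a
   continuous projection to M whose fibers are finite-dimensional vector
   spaces.  The type {p : M & fam_fiber p} only describes the points of the
   total space and the vector space structure of the fibers; its
   disjoint-union topology plays no role. *)
Record family (R : realType) (M : topologicalType) := Family {
  fam_total : topologicalType;
  fam_fiber : M -> vectType R;
  fam_split : fam_total -> {p : M & fam_fiber p};
  fam_join : {p : M & fam_fiber p} -> fam_total;
  fam_splitK : cancel fam_split fam_join;
  fam_joinK : cancel fam_join fam_split;
  fam_proj_continuous : continuous (fun x : fam_total => tag (fam_split x))
}.

Definition fam_proj (R : realType) (M : topologicalType) (E : family R M)
    (x : fam_total E) : M := tag (fam_split x).

(* Local trivializations of rank k of E over an open set U: homeomorphisms from
   the preimage of U onto U x R^k that commute with the projections to U and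
   are linear isomorphisms [bc_fun p] on the fiber over each p in U. *)
Record bundle_chart (R : realType) (M : topologicalType) (E : family R M)
    (k : nat) := BundleChart {
  bc_dom : set M;
  bc_fun : forall p : M, 'Hom(fam_fiber E p, 'rV[R]_k);
  bc_dom_open : open bc_dom;
  bc_inj : forall p, bc_dom p -> lker (bc_fun p) = 0%VS;
  bc_surj : forall p, bc_dom p -> limg (bc_fun p) = fullv;
  bc_continuous :
    {within @fam_proj R M E @^-1` bc_dom, continuous
      (fun x : fam_total E =>
        (fam_proj x, bc_fun (fam_proj x) (tagged (fam_split x))))};
  bc_inv_continuous :
    {within bc_dom `*` [set: 'rV[R]_k], continuous
      (fun py : M * 'rV[R]_k =>
        @fam_join R M E
          (Tagged (fam_fiber E) ((bc_fun py.1)^-1%VF py.2)))}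
}.

(* The matrix of b_p \o a_p^-1, acting on row vectors from the right. *)
Definition transition (R : realType) (M : topologicalType) (E : family R M)
    (k : nat) (a b : bundle_chart E k) (p : M) : 'M[R]_k :=
  lin1_mx (bc_fun b p \o (bc_fun a p)^-1)%VF.

(* Smooth real vector bundles of rank k. *)
Record vector_bundle (R : realType) (m : nat) (M : manifold R m) (k : nat) :=
  VectorBundle {
  vb_family :> family R M;
  vb_atlas : set (bundle_chart vb_family k);
  vb_atlas_cover : forall p, exists2 a, vb_atlas a & bc_dom a p;
  vb_atlas_smooth : forall a b, vb_atlas a -> vb_atlas b ->
    forall i j : 'I_k,
      smooth_fun (bc_dom a `&` bc_dom b) (fun p => transition a b p i j)
}.

Definition orientable (R : realType) (m : nat) (M : manifold R m) (k : nat)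
    (E : vector_bundle M k) : Prop :=
  exists O : set (bundle_chart E k),
    (forall p, exists2 a, O a & bc_dom a p) /\
    (forall a b, O a -> O b ->
      forall p, bc_dom a p -> bc_dom b p -> 0 < \det (transition a b p)).

(* The smoothness of the inner products is expressed by their Gram matrices in
   the local frames given by the smooth local trivializations. *)
Record riemannian (R : realType) (m : nat) (M : manifold R m) (k : nat)
    (E : vector_bundle M k) := Riemannian {
  rm_dot : forall p : M, {dot (fam_fiber E p) for (@idfun R)};
  rm_smooth : forall a, vb_atlas a -> forall i j : 'I_k,
    smooth_fun (bc_dom a)
      (fun p => rm_dot p ((bc_fun a p)^-1%VF (delta_mx 0 i))
                         ((bc_fun a p)^-1%VF (delta_mx 0 j)))
}.

Section HomBundle.
Variables (R : realType) (m : nat) (M : manifold R m) (k : nat).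
Variables (E : vector_bundle M k) (n : nat).

(* The total space of Hom(M x R^n, E). *)
Record hom_bundle := HomPoint {
  hom_base : M;
  hom_map : 'Hom('rV[R]_n, fam_fiber E hom_base)
}.

(* The inverse of the local trivialization of Hom(M x R^n, E) induced by the
   local trivialization a of E: a point (p, B) is sent to the linear map
   x |-> a_p^-1 (x *m B) over p. *)
Definition hom_chart_inv (a : bundle_chart E k) (pB : M * 'M[R]_(n, k)) :
    hom_bundle :=
  HomPoint ((bc_fun a pB.1)^-1 \o linfun (mulmxr pB.2))%VF.

(* The vector bundle topology of Hom(M x R^n, E). *)
Definition hom_open (W : set hom_bundle) : Prop :=
  forall a : bundle_chart E k, vb_atlas a ->
    open ((bc_dom a `*` [set: 'M[R]_(n, k)]) `&` (hom_chart_inv a @^-1` W)).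

HB.instance Definition _ := gen_eqMixin hom_bundle.
HB.instance Definition _ := gen_choiceMixin hom_bundle.

Lemma hom_openT : hom_open setT.
Proof.
move=> a _; rewrite preimage_setT setIT setXT.
by apply: open_comp => [x _|]; [exact: cvg_fst | exact: bc_dom_open].
Qed.

Lemma hom_openI : setI_closed hom_open.
Proof.
move=> V W oV oW a Aa; rewrite preimage_setI setIIr.
by apply: openI; [exact: oV | exact: oW].
Qed.

Lemma hom_open_bigU (I : Type) (f : I -> set hom_bundle) :
  (forall i, hom_open (f i)) -> hom_open (\bigcup_i f i).
Proof.
move=> of_ a Aa; rewrite preimage_bigcup setI_bigcupr.
by apply: bigcup_open => i _; exact: of_.
Qed.

HB.instance Definition _ :=
  isOpenTopological.Build hom_bundle hom_openT hom_openI hom_open_bigU.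

Definition frame_bundle : set hom_bundle :=
  [set x | limg (hom_map x) = fullv].

End HomBundle.

Arguments frame_bundle {R m M k} E n _.

(* B is the adjoint of A with respect to the standard inner product of R^n and
   the inner product g of V. *)
Definition is_adjoint (R : realType) (n : nat) (V : vectType R)
    (g : {dot V for (@idfun R)}) (A : 'Hom('rV[R]_n, V))
    (B : 'Hom(V, 'rV[R]_n)) : Prop :=
  forall (x : 'rV[R]_n) (v : V), g (A x) v = \sum_(i < n) x 0 i * B v 0 i.

Definition parseval_bundle (R : realType) (m : nat) (M : manifold R m)
    (k : nat) (E : vector_bundle M k) (g : riemannian E) (n : nat) :
    set (hom_bundle E n) :=
  [set x | frame_bundle E n x /\
    exists2 B, is_adjoint (rm_dot g (hom_base x)) (hom_map x) B
             & (hom_map x \o B)%VF = \1%VF].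

Arguments parseval_bundle {R m M k E} g n _.

Definition frame_proj (R : realType) (m : nat) (M : manifold R m) (k : nat)
    (E : vector_bundle M k) (n : nat) (x : frame_bundle E n) : M :=
  hom_base (set_val x).

(* Main.v *)
(* For a frame A : R^n -> V put T = (A A^T)^(1/2), a positive self-adjoint
   automorphism of V; then T^-1 A is a Parseval frame, and
   H(A, t) = ((1 - t) I + t T^-1) A is a homotopy through frames which fixes the
   Parseval frames, for which T = I.  As T only depends on the inner product of
   V, H is defined on the whole bundle, and its continuity can be checked in
   local trivializations, where it reduces to the continuity of the square root
   of positive definite matrices.  The latter follows from the estimate
   |P - Q|^2 <= K |P^2 - Q^2|^2, with K depending on P only, which also gives
   the uniqueness of the square root. *)
Require Import Defs.
From HB Require Import structures.
From mathcomp Require Import all_boot all_order all_algebra.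
From mathcomp Require Import all_classical all_reals all_analysis.
From mathcomp Require Import ring lra.
From mathcomp Require complex spectral.
Import Order.TTheory GRing.Theory Num.Theory.
Import numFieldNormedType.Exports.
Local Open Scope classical_set_scope.
Local Open Scope ring_scope.

Set Implicit Arguments.
Unset Strict Implicit.
Unset Printing Implicit Defensive.

(** * Positive definite matrices over a real closed field *)

Section PosDef.
Variable R : rcfType.

Definition posdefmx k (S : 'M[R]_k) : Prop :=
  S^T = S /\ forall v : 'rV_k, v != 0 -> 0 < (v *m S *m v^T) 0 0.

Lemma mx11_sqr k (v : 'rV[R]_k) : (v *m v^T) 0 0 = \sum_i v 0 i ^+ 2.
Proof. by rewrite mxE; apply: eq_bigr => i _; rewrite mxE expr2. Qed.

Lemma mx11_sqr_gt0 k (v : 'rV[R]_k) : v != 0 -> 0 < (v *m v^T) 0 0.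
Proof.
move=> v0; rewrite mx11_sqr lt_neqAle sumr_ge0 ?andbT; last first.
  by move=> i _; exact: sqr_ge0.
apply: contra v0; rewrite eq_sym psumr_eq0 => [/allP v0|i _]; last first.
  exact: sqr_ge0.
apply/eqP/rowP => i; rewrite mxE; apply/eqP.
by rewrite -sqrf_eq0; apply: (implyP (v0 i _)) => //; rewrite mem_index_enum.
Qed.

Lemma posdef_unit k (S : 'M[R]_k) : posdefmx S -> S \in unitmx.
Proof.
move=> [_ S_gt0]; rewrite -row_free_unit; apply: inj_row_free => v vS0.
by apply/eqP/negPn/negP => /S_gt0; rewrite vS0 mul0mx mxE ltxx.
Qed.

Lemma posdef_congr k (S C : 'M[R]_k) : C \in unitmx -> posdefmx S ->
  posdefmx (C *m S *m C^T).
Proof.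
move=> Cu [Ssym S_gt0]; split; first by rewrite !trmx_mul trmxK Ssym mulmxA.
move=> v v0; rewrite !mulmxA -mulmxA -trmx_mul; apply: S_gt0.
by apply: contra v0 => /eqP vC; rewrite -[v](mulmxK Cu) vC mul0mx.
Qed.

Lemma posdef_inv k (S : 'M[R]_k) : posdefmx S -> posdefmx (invmx S).
Proof.
move=> Spd; have Su := posdef_unit Spd; have [Ssym _] := Spd.
have -> : invmx S = invmx S *m S *m (invmx S)^T.
  by rewrite trmx_inv Ssym mulVmx // mul1mx.
by apply: posdef_congr => //; rewrite unitmx_inv.
Qed.

(** A left inverse of [B] recovers [v] from [v *m B^T], so the latter is nonzero for [v != 0]; its
    squared length is the quadratic form at [v]. *)
Lemma posdef_gram n k (B : 'M[R]_(n, k)) : row_full B -> posdefmx (B^T *m B).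
Proof.
move=> Bfull; split=> [|v v0]; first by rewrite trmx_mul trmxK.
rewrite mulmxA -{2}[B]trmxK -mulmxA -trmx_mul; apply: mx11_sqr_gt0.
apply: contra v0 => /eqP vB; rewrite -[v]mulmx1.
by have /row_fullP[D DB] := Bfull; rewrite -trmx1 -DB trmx_mul mulmxA vB mul0mx.
Qed.

Lemma posdef_convex k (S : 'M[R]_k) (t : R) : 0 <= t <= 1 -> posdefmx S ->
  posdefmx ((1 - t)%:M + t *: S).
Proof.
move=> /andP[t0 t1] [Ssym S_gt0]; split.
  by rewrite linearD linearZ /= tr_scalar_mx Ssym.
move=> v v0; rewrite mulmxDr mulmxDl mul_mx_scalar -scalemxAr -!scalemxAl.
rewrite mxE [X in X + _]mxE [X in _ + X]mxE.
(* At [t = 0] strict positivity comes from the identity; for [t > 0] it comes from [S], the identity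
   term being at least nonnegative. *)
move: t0; rewrite le_eqVlt => /predU1P[<-|t0].
  by rewrite subr0 mul0r addr0 mul1r mx11_sqr_gt0.
rewrite ltr_wpDl ?mulr_gt0 ?S_gt0 // mulr_ge0 ?subr_ge0 //.
exact/ltW/mx11_sqr_gt0.
Qed.

End PosDef.

(** * Square roots of unitarily diagonalized complex matrices *)

Section UnitaryRoot.
Variable C : numClosedFieldType.
Import spectral.
Local Open Scope sesquilinear_scope.
Local Notation cj := (map_mx Num.conj).

(* [cj P *m P^t*] commutes with [diag_mx d] because [S] is real, hence it
   commutes with [diag_mx s], which in turn means that [Q] is real. *)
Lemma unitary_root_real k (P S : 'M[C]_k) (d s : 'rV[C]_k) :
    P \is unitarymx -> cj S = S -> cj d = d -> cj s = s ->
    S = P ^t* *m diag_mx d *m P ->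
    (forall i j, d 0 i = d 0 j -> s 0 i = s 0 j) ->
  cj (P ^t* *m diag_mx s *m P) = P ^t* *m diag_mx s *m P.
Proof.
move=> /unitarymxP PP SC dC sC SE ds; pose U := cj P *m P ^t*.
have PP' : P ^t* *m P = 1%:M by apply: mulmx1C.
have PtC : cj (P ^t*) = P^T.
  by rewrite -map_mx_comp map_mx_id // => x /=; rewrite conjCK.
have PtP : cj P *m P^T = 1%:M by rewrite -PtC -map_mxM PP map_mx1.
have PtP' : P^T *m cj P = 1%:M by apply: mulmx1C.
have Ud : U *m diag_mx d = diag_mx d *m U.
  transitivity (cj P *m S *m P ^t*).
    by rewrite SE /U -!mulmxA PP mulmx1.
  by rewrite -SC SE !map_mxM PtC map_diag_mx dC !mulmxA PtP mul1mx -mulmxA.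
have UD : U *m diag_mx s = diag_mx s *m U.
  apply/matrixP => i j; move/matrixP/(_ i j): Ud.
  rewrite !(mul_mx_diag, mul_diag_mx) ![(\matrix_(_, _) _) i j]mxE.
  (* A nonzero entry [U i j] forces [d] to agree at [i] and [j], hence [s] as well. *)
  have [->|u0] := eqVneq (U i j) 0; first by rewrite !mul0r !mulr0.
  by rewrite !(mulrC _ (U i j)) => /(mulfI u0)/ds ->.
rewrite !map_mxM PtC map_diag_mx sC.
transitivity (P^T *m (diag_mx s *m U) *m P).
  by rewrite /U -!mulmxA PP' mulmx1.
by rewrite -UD /U !mulmxA PtP' mul1mx.
Qed.

Lemma unitary_root_sqr k (P : 'M[C]_k) (s : 'rV[C]_k) : P \is unitarymx ->
  (P ^t* *m diag_mx s *m P) *m (P ^t* *m diag_mx s *m P) =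
  P ^t* *m diag_mx (\row_i (s 0 i ^+ 2)) *m P.
Proof.
move=> /unitarymxP PP; rewrite !mulmxA -(mulmxA _ P) PP mulmx1.
by rewrite -(mulmxA (P ^t*)) mulmx_diag.
Qed.

Lemma unitary_root_herm k (P : 'M[C]_k) (s : 'rV[C]_k) : cj s = s ->
  (P ^t* *m diag_mx s *m P) ^t* = P ^t* *m diag_mx s *m P.
Proof.
move=> sC; rewrite !trmx_mul tr_diag_mx !map_mxM map_diag_mx sC mulmxA.
by rewrite trmxCK.
Qed.

(** In the coordinates [w = v *m P ^t*] the form is the sum of the [s 0 i * |w 0 i|^2]. *)
Lemma unitary_root_gt0 k (P : 'M[C]_k) (s v : 'rV[C]_k) : P \is unitarymx ->
  (forall i, 0 < s 0 i) -> v != 0 ->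
  0 < (v *m (P ^t* *m diag_mx s *m P) *m v ^t*) 0 0.
Proof.
move=> /unitarymxP PP s_gt0 v0; pose w := v *m P ^t*.
have PP' : P ^t* *m P = 1%:M by apply: mulmx1C.
have w0 : w != 0.
  by apply: contra v0 => /eqP w0; rewrite -[v]mulmx1 -PP' mulmxA -/w w0 mul0mx.
have -> : v *m (P ^t* *m diag_mx s *m P) *m v ^t* = w *m diag_mx s *m w ^t*.
  by rewrite /w trmx_mul map_mxM trmxCK !mulmxA.
have term i : 0 <= s 0 i * (w 0 i * (w 0 i)^*).
  by rewrite mulr_ge0 ?mul_conjC_ge0 // ltW.
have -> : (w *m diag_mx s *m w ^t*) 0 0 = \sum_i s 0 i * (w 0 i * (w 0 i)^*).
  rewrite mxE; apply: eq_bigr => i _.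
  rewrite mul_mx_diag [(\matrix_(_, _) _) _ _]mxE -mulrA mulrCA.
  by rewrite [(w ^t*) _ _]mxE [w^T _ _]mxE.
rewrite lt_neqAle sumr_ge0 ?andbT // eq_sym psumr_eq0 //.
apply: contra w0 => /allP w0; apply/eqP/rowP => i; rewrite [RHS]mxE.
have := implyP (w0 i (mem_index_enum i)) isT.
by rewrite mulf_eq0 mul_conjC_eq0 (gt_eqF (s_gt0 i)) => /eqP.
Qed.

End UnitaryRoot.

(** * Existence of the square root of a real positive definite matrix *)

Section PosDefRoot.
Variable R : rcfType.
Import complex spectral.
Local Open Scope sesquilinear_scope.
Local Notation C := (complex R).
Local Notation f := (real_complex R).
Local Notation cj := (map_mx Num.conj).

Lemma conj_real_complex (x : R) : Num.conj (f x) = f x.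
Proof. by apply/CrealP/complex_realP; exists x. Qed.

Lemma conj_map_real m n (A : 'M[R]_(m, n)) : cj (map_mx f A) = map_mx f A.
Proof. by apply/matrixP => i j; rewrite !mxE; exact: conj_real_complex. Qed.

Lemma map_Re_mulmx m n p (A : 'M[C]_(m, n)) (S : 'M[R]_(n, p)) :
  map_mx (@complex.Re R) (A *m map_mx f S) = map_mx (@complex.Re R) A *m S.
Proof.
apply/matrixP => i j; rewrite !mxE.
rewrite (raddf_sum (@complex.Re R : Rcomplex R -> R)).
apply: eq_bigr => l _; rewrite !mxE; case: (A i l) => a b /=.
by rewrite mulr0 subr0.
Qed.

Lemma map_Im_mulmx m n p (A : 'M[C]_(m, n)) (S : 'M[R]_(n, p)) :
  map_mx (@complex.Im R) (A *m map_mx f S) = map_mx (@complex.Im R) A *m S.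
Proof.
apply/matrixP => i j; rewrite !mxE.
rewrite (raddf_sum (@complex.Im R : Rcomplex R -> R)).
apply: eq_bigr => l _; rewrite !mxE; case: (A i l) => a b /=.
by rewrite mulr0 add0r.
Qed.

(** The real or the imaginary part [x] of [z] is a nonzero real eigenvector for [r], and then
    [x *m S *m x^T] is [r] times the squared length of [x]. *)
Lemma posdef_eigenvalue_gt0 k (S : 'M[R]_k) (z : 'rV[C]_k) (r : R) :
  posdefmx S -> z != 0 -> z *m map_mx f S = f r *: z -> 0 < r.
Proof.
move=> [_ S_gt0] z0 zS.
have eigen (x : 'rV[R]_k) : x != 0 -> x *m S = r *: x -> 0 < r.
  move=> x0 xS; have := S_gt0 _ x0; rewrite xS -scalemxAl mxE.
  by rewrite pmulr_lgt0 // mx11_sqr_gt0.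
have [x0|x0] := eqVneq (map_mx (@complex.Re R) z) 0; last first.
  apply: (eigen _ x0); rewrite -map_Re_mulmx zS.
  apply/rowP => i; rewrite !mxE; case: (z 0 i) => a b /=.
  by rewrite mul0r subr0.
have y0 : map_mx (@complex.Im R) z != 0.
  apply: contra z0 => /eqP y0; apply/eqP/rowP => i.
  move/rowP/(_ i): x0; move/rowP/(_ i): y0; rewrite !mxE.
  by case: (z 0 i) => a b /= -> ->.
apply: (eigen _ y0); rewrite -map_Im_mulmx zS.
apply/rowP => i; rewrite !mxE; case: (z 0 i) => a b /=.
by rewrite mul0r addr0.
Qed.

(** The spectral theorem is applied to the complexification of [S]; the square roots of the
    eigenvalues give a Hermitian root [Q], which is real by [unitary_root_real]. *)
Lemma posdef_sqrt_ex k (S : 'M[R]_k) : posdefmx S ->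
  exists2 Q, posdefmx Q & Q *m Q = S.
Proof.
move=> Spd; pose Sc := map_mx f S.
have ScC : cj Sc = Sc by exact: conj_map_real.
have Sherm : Sc \is hermsymmx.
  by apply/is_hermitianmxP; rewrite expr0 scale1r -map_trmx ScC map_trmx Spd.1.
have [P [d [Punit dreal SE]]] : exists (P : 'M[C]_k) (d : 'rV[C]_k),
    [/\ P \is unitarymx, d \is a realmx & Sc = P ^t* *m diag_mx d *m P].
  exists (spectralmx Sc), (spectral_diag Sc).
  rewrite spectral_unitarymx hermitian_spectral_diag_real //; split=> //.
  rewrite -invmx_unitary ?spectral_unitarymx //.
  exact/orthomx_spectralP/hermitian_normalmx.
have dC : cj d = d by exact: realmxC.
pose e : 'rV[R]_k := map_mx (@complex.Re R) d.
have dE : d = map_mx f e.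
  apply/rowP => i; rewrite !mxE RRe_real //.
  by apply/CrealP; move/rowP/(_ i): dC; rewrite mxE.
(* Row [i] of [P] is a unit eigenvector of [Sc] with eigenvalue [e 0 i]. *)
have e_gt0 i : 0 < e 0 i.
  apply: (@posdef_eigenvalue_gt0 _ S (row i P)) => //.
    have /row_unitarymxP/(_ i i) := Punit.
    apply: contra_eqN => /eqP ->; rewrite linear0l eqxx eq_sym oner_eq0 //.
  rewrite -/Sc SE -row_mul !mulmxA (unitarymxP Punit) mul1mx row_mul.
  by rewrite row_diag_mx -scalemxAl -rowE dE mxE.
pose r : 'rV[R]_k := map_mx (@Num.sqrt R) e.
have r_gt0 i : 0 < r 0 i by rewrite mxE sqrtr_gt0.
have sC : cj (map_mx f r) = map_mx f r by exact: conj_map_real.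
pose Q := P ^t* *m diag_mx (map_mx f r) *m P.
have QQ : Q *m Q = Sc.
  transitivity (P ^t* *m diag_mx (\row_i (map_mx f r 0 i ^+ 2)) *m P).
    exact: unitary_root_sqr.
  rewrite SE; have -> // : \row_i (map_mx f r 0 i ^+ 2) = d.
  apply/rowP => i; rewrite dE [LHS]mxE ![map_mx f _ _ _]mxE -rmorphXn /=.
  by congr (f _); rewrite mxE sqr_sqrtr // ltW.
(* The entries of [r] are computed from those of [e], so equal eigenvalues have equal roots. *)
have QC : cj Q = Q.
  apply: (unitary_root_real Punit ScC dC sC SE) => i j.
  by rewrite dE ![map_mx f _ _ _]mxE => /complexI ij; rewrite ![r _ _]mxE ij.
have QH : Q ^t* = Q by exact: unitary_root_herm.
pose q := map_mx (@complex.Re R) Q.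
have qE : map_mx f q = Q.
  apply/matrixP => i j; rewrite [LHS]mxE [q _ _]mxE RRe_real //.
  by apply/CrealP; move/matrixP/(_ i j): QC; rewrite mxE.
have inj m n : injective (@map_mx _ _ f m n).
  move=> A B /matrixP AB; apply/matrixP => i j.
  by have := AB i j; rewrite !mxE => /complexI.
exists q; last by apply: inj; rewrite map_mxM qE.
split; first apply: inj.
  by rewrite -map_trmx qE -[RHS]QH -map_trmx QC.
move=> v v0; rewrite -ltcR; have -> : f ((v *m q *m v^T) 0 0) =
    (map_mx f v *m Q *m (map_mx f v) ^t*) 0 0.
  by rewrite -map_trmx conj_map_real map_trmx -qE -!map_mxM [RHS]mxE.
apply: unitary_root_gt0 => //.
  by move=> i; rewrite mxE ltcR.
apply: contra v0 => /eqP v0; apply/eqP/inj.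
by rewrite map_mx0.
Qed.
End PosDefRoot.

(** * Estimates in the Frobenius norm and uniqueness of the square root *)

Section Frobenius.
Variable R : rcfType.

(** This trace is the squared Frobenius norm, the form in which the norm enters the estimates
    below. *)
Lemma mxtrace_mul_tr m n (A : 'M[R]_(m, n)) :
  \tr (A *m A^T) = \sum_i \sum_j A i j ^+ 2.
Proof.
rewrite /mxtrace; apply: eq_bigr => i _.
by rewrite mxE; apply: eq_bigr => j _; rewrite mxE expr2.
Qed.

Lemma mxtrace_mul_tr_ge0 m n (A : 'M[R]_(m, n)) : 0 <= \tr (A *m A^T).
Proof.
by rewrite mxtrace_mul_tr; apply: sumr_ge0 => i _; apply: sumr_ge0 => j _;
  exact: sqr_ge0.
Qed.

Lemma sqr_entry_le_mxtrace m n (A : 'M[R]_(m, n)) i j :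
  A i j ^+ 2 <= \tr (A *m A^T).
Proof.
rewrite mxtrace_mul_tr (bigD1 i) //= (bigD1 j) //= -addrA lerDl addr_ge0 //.
  by apply: sumr_ge0 => l _; exact: sqr_ge0.
by apply: sumr_ge0 => l _; apply: sumr_ge0 => l' _; exact: sqr_ge0.
Qed.

(** The Cauchy-Schwarz inequality, by Lagrange's identity: the double sum of the
    [(a i * b j - a j * b i) ^+ 2] is twice the difference of the two sides. *)
Lemma sum_mul_sqr_le n (a b : 'I_n -> R) :
  (\sum_i a i * b i) ^+ 2 <= (\sum_i a i ^+ 2) * (\sum_i b i ^+ 2).
Proof.
have : 0 <= \sum_i \sum_j (a i * b j - a j * b i) ^+ 2.
  by apply: sumr_ge0 => i _; apply: sumr_ge0 => j _; exact: sqr_ge0.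
have -> : \sum_i \sum_j (a i * b j - a j * b i) ^+ 2 =
    \sum_i \sum_j a i ^+ 2 * b j ^+ 2 + \sum_i \sum_j a j ^+ 2 * b i ^+ 2 -
    2 * \sum_i \sum_j (a i * b i) * (a j * b j).
  rewrite mulr_sumr -big_split -sumrB; apply: eq_bigr => i _ /=.
  rewrite mulr_sumr -big_split -sumrB; apply: eq_bigr => j _ /=.
  by ring.
rewrite [X in _ + X - _]exchange_big /= -!big_distrlr /= expr2.
by lra.
Qed.

Lemma mxtrace_mulmx_le m n p (A : 'M[R]_(m, n)) (B : 'M[R]_(n, p)) :
  \tr ((A *m B) *m (A *m B)^T) <= \tr (A *m A^T) * \tr (B *m B^T).
Proof.
rewrite !mxtrace_mul_tr [X in _ <= _ * X]exchange_big big_distrlr /=.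
apply: ler_sum => i _; apply: ler_sum => j _; rewrite mxE.
exact: sum_mul_sqr_le.
Qed.

Lemma mxtrace_posdef_ge0 m k (P : 'M[R]_k) (D : 'M[R]_(m, k)) :
  posdefmx P -> 0 <= \tr (D *m P *m D^T).
Proof.
move=> [Psym P_gt0]; apply: sumr_ge0 => i _.
have -> : (D *m P *m D^T) i i = (row i D *m P *m (row i D)^T) 0 0.
  rewrite -row_mul [LHS]mxE [RHS]mxE; apply: eq_bigr => l _.
  by rewrite ![(_^T) _ _]mxE ![row _ _ _ _]mxE.
have [->|/P_gt0/ltW//] := eqVneq (row i D) 0.
by rewrite !mul0mx mxE.
Qed.

(** For a root [L] of [P], write [D] as [D *m L *m invmx L]: the squared norm of [D *m L] is
    [\tr (D *m P *m D^T)], and [K] is the squared norm of [invmx L]. *)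
Lemma posdef_coercive k (P : 'M[R]_k) : posdefmx P ->
  exists2 K, 0 <= K & forall m (D : 'M[R]_(m, k)),
    \tr (D *m D^T) <= K * \tr (D *m P *m D^T).
Proof.
move=> /posdef_sqrt_ex[L Lpd LL]; exists (\tr (invmx L *m (invmx L)^T)).
  exact: mxtrace_mul_tr_ge0.
move=> m D; rewrite -{1 2}(mulmxK (posdef_unit Lpd) D) mulrC.
apply: le_trans (mxtrace_mulmx_le _ _) _.
by rewrite trmx_mul Lpd.1 -LL !mulmxA.
Qed.

(* With D = P - Q and E = P^2 - Q^2 = P D + D Q, both terms of
   tr (D E) = tr (D P D) + tr (D Q D) are nonnegative. *)
Lemma posdef_sqrt_lipschitz k (P : 'M[R]_k) : posdefmx P ->
  exists2 K, 0 <= K & forall Q, posdefmx Q ->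
    \tr ((P - Q) *m (P - Q)^T) <=
    K * \tr ((P *m P - Q *m Q) *m (P *m P - Q *m Q)^T).
Proof.
move=> Ppd; have [K K0 coer] := posdef_coercive Ppd.
exists (K ^+ 2); first exact: sqr_ge0.
move=> Q Qpd; set D := P - Q; set E := _ - Q *m Q.
have Dsym : D^T = D by rewrite /D linearB /= Ppd.1 Qpd.1.
have DE : \tr (D *m E) = \tr (D *m P *m D^T) + \tr (D *m Q *m D^T).
  rewrite Dsym [X in _ + X]mxtrace_mulC -!mulmxA -mxtraceD -mulmxDr.
  congr (\tr (_ *m _)).
  by rewrite /E /D mulmxBr mulmxBl addrA subrK.
have Esym : E^T = E by rewrite /E linearB /= !trmx_mul Ppd.1 Qpd.1.
have DD : \tr (D *m D^T) <= K * \tr (D *m E).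
  apply: (le_trans (coer _ D)); rewrite DE mulrDr lerDl mulr_ge0 //.
  exact: mxtrace_posdef_ge0.
(* This is [2 * x * y <= x ^+ 2 + y ^+ 2] with [x = D i j] and [y = K * E i j], summed over the
   entries. Combined with twice [DD] it leaves the constant [K ^+ 2]. *)
have KDE : 2 * (K * \tr (D *m E)) <= \tr (D *m D^T) + K ^+ 2 * \tr (E *m E^T).
  have -> : \tr (D *m E) = \sum_i \sum_j D i j * E i j.
    rewrite -Esym /mxtrace; apply: eq_bigr => i _; rewrite mxE.
    by apply: eq_bigr => j _; rewrite [E^T _ _]mxE Esym.
  rewrite !mxtrace_mul_tr !mulr_sumr -big_split; apply: ler_sum => i _ /=.
  rewrite !mulr_sumr -big_split; apply: ler_sum => j _ /=.
  by have := sqr_ge0 (D i j - K * E i j); lra.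
by lra.
Qed.

(** When the squares agree, the bound of [posdef_sqrt_lipschitz] is zero, and it dominates the
    square of every entry of [P - Q]. *)
Lemma posdef_sqrt_uniq k (P Q : 'M[R]_k) : posdefmx P -> posdefmx Q ->
  P *m P = Q *m Q -> P = Q.
Proof.
move=> Ppd Qpd PQ; have [K _ /(_ Q Qpd)] := posdef_sqrt_lipschitz Ppd.
rewrite PQ subrr mul0mx mxtrace0 mulr0 => PQ0.
apply/matrixP => i j; apply/eqP.
rewrite -subr_eq0 -sqrf_eq0 eq_le sqr_ge0 andbT.
by have := le_trans (sqr_entry_le_mxtrace (P - Q) i j) PQ0; rewrite !mxE.
Qed.

End Frobenius.

(** * The retraction in coordinates *)

Section ParsevalMatrix.
Variable R : rcfType.

(** The root is picked by choice, with default 0 when there is none; it is unique by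
    [posdef_sqrt_uniq]. *)
Definition sqrtmx k (S : 'M[R]_k) : 'M[R]_k :=
  xget 0 [set Q | posdefmx Q /\ Q *m Q = S].

Lemma sqrtmxP k (S : 'M[R]_k) : posdefmx S ->
  posdefmx (sqrtmx S) /\ sqrtmx S *m sqrtmx S = S.
Proof.
move=> /posdef_sqrt_ex[Q Qpd QQ]; rewrite /sqrtmx.
by case: xgetP => // /(_ Q)[].
Qed.

Lemma sqrtmx_uniq k (Q : 'M[R]_k) : posdefmx Q -> sqrtmx (Q *m Q) = Q.
Proof.
move=> Qpd; rewrite /sqrtmx; case: xgetP => [P _ [Ppd]|/(_ Q)[]//].
exact: posdef_sqrt_uniq.
Qed.

(** The operator [A A^T] in coordinates that are orthonormal for [G], in which the matrix of the
    frame is [B *m sqrtmx G]. *)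
Definition gram_normalized n k (G : 'M[R]_k) (B : 'M[R]_(n, k)) : 'M[R]_k :=
  sqrtmx G *m (B^T *m B) *m sqrtmx G.

(* In the coordinates given by a basis of V with Gram matrix G, a frame
   A : R^n -> V is the n x k matrix B with A x = x *m B, the operator A A^T is
   right multiplication by T^2 = G *m B^T *m B, and this is right
   multiplication by T^-1, where T is the positive square root. *)
Definition inv_sqrt_frame n k (G : 'M[R]_k) (B : 'M[R]_(n, k)) : 'M[R]_k :=
  sqrtmx G *m invmx (sqrtmx (gram_normalized G B)) *m invmx (sqrtmx G).

Lemma gram_normalized_posdef n k (G : 'M[R]_k) (B : 'M[R]_(n, k)) :
  posdefmx G -> row_full B -> posdefmx (gram_normalized G B).
Proof.
move=> /sqrtmxP[Wpd _] /posdef_gram; rewrite /gram_normalized.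
rewrite -{2}Wpd.1; apply: posdef_congr; exact: posdef_unit.
Qed.

(** The hypothesis on [T *m G] says that [T], acting from the right, is self-adjoint and positive
    for [G]. Its conjugate [q] by [W] is then a positive definite root of [gram_normalized G B],
    hence the only one. *)
Lemma inv_sqrt_frame_uniq n k (G T : 'M[R]_k) (B : 'M[R]_(n, k)) :
    posdefmx G -> posdefmx (T *m G) -> T *m T = G *m (B^T *m B) ->
  inv_sqrt_frame G B = invmx T.
Proof.
move=> Gpd TGpd TT; have [Wpd WW] := sqrtmxP Gpd.
have Wu := posdef_unit Wpd; rewrite /inv_sqrt_frame /gram_normalized.
set W := sqrtmx G in Wpd WW Wu *; set q := invmx W *m T *m W.
have qpd : posdefmx q.
  have -> : q = invmx W *m (T *m G) *m (invmx W)^T.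
    by rewrite trmx_inv Wpd.1 -WW !mulmxA mulmxK.
  by apply: posdef_congr; rewrite ?unitmx_inv.
have -> : W *m (B^T *m B) *m W = q *m q.
  rewrite /q !mulmxA mulmxK // -(mulmxA (invmx W)) TT -WW.
  by rewrite !mulmxA mulVmx // mul1mx.
rewrite sqrtmx_uniq //.
have Tu : T \in unitmx.
  by have := posdef_unit TGpd; rewrite unitmx_mul => /andP[].
apply: (can_inj (mulmxK Tu)); rewrite mulVmx //.
have WT : invmx W *m T = q *m invmx W by rewrite /q mulmxK.
rewrite -(mulmxA _ _ T) WT mulmxA -(mulmxA W) mulVmx ?mulmx1 ?mulmxV //.
exact: posdef_unit.
Qed.

(** Conjugating the root [N] of [gram_normalized G B] back by [W] gives [T], and
    [T *m G = W *m N *m W] is congruent to [N]. *)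
Lemma inv_sqrt_frameP n k (G : 'M[R]_k) (B : 'M[R]_(n, k)) :
    posdefmx G -> row_full B ->
  exists T, [/\ posdefmx (T *m G), T *m T = G *m (B^T *m B) &
    inv_sqrt_frame G B = invmx T].
Proof.
move=> Gpd Bfull; have [Wpd WW] := sqrtmxP Gpd.
have Wu := posdef_unit Wpd.
have [Npd NN] := sqrtmxP (gram_normalized_posdef Gpd Bfull).
set W := sqrtmx G in Wpd WW Wu NN; set N := sqrtmx _ in Npd NN.
pose T := W *m N *m invmx W.
have Tpd : posdefmx (T *m G).
  rewrite /T -WW !mulmxA mulmxKV // -{2}Wpd.1.
  exact: posdef_congr.
have TT : T *m T = G *m (B^T *m B).
  rewrite /T !mulmxA mulmxKV // -(mulmxA W) NN /gram_normalized -/W.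
  by rewrite -WW !mulmxA mulmxK.
by exists T; rewrite (inv_sqrt_frame_uniq Gpd Tpd TT).
Qed.

(** [C] is a change of basis: [invmx C *m T *m C] satisfies in the new coordinates what
    characterizes [T] in the old ones, so [inv_sqrt_frame_uniq] identifies it. *)
Lemma inv_sqrt_frame_congr n k (G G' C : 'M[R]_k) (B : 'M[R]_(n, k)) :
    C \in unitmx -> posdefmx G' -> row_full B -> G = C *m G' *m C^T ->
  C *m inv_sqrt_frame G' (B *m C) = inv_sqrt_frame G B *m C.
Proof.
move=> Cu G'pd Bfull GE.
have Gpd : posdefmx G by rewrite GE; exact: posdef_congr.
have [T [TGpd TT ->]] := inv_sqrt_frameP Gpd Bfull.
have Tu : T \in unitmx.
  by have := posdef_unit TGpd; rewrite unitmx_mul => /andP[].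
have CtK : C^T *m (invmx C)^T = 1%:M by rewrite -trmx_mul mulVmx // trmx1.
rewrite (@inv_sqrt_frame_uniq _ _ _ (invmx C *m T *m C)) //.
- apply: (can_inj (mulKmx Tu)); rewrite mulKVmx // mulmxA.
  have -> : T *m C = C *m (invmx C *m T *m C) by rewrite -mulmxA mulKVmx.
  by rewrite mulmxK // !unitmx_mul unitmx_inv Cu Tu.
- have -> : invmx C *m T *m C *m G' = invmx C *m (T *m G) *m (invmx C)^T.
    by rewrite GE -!mulmxA CtK mulmx1.
  by apply: posdef_congr; rewrite ?unitmx_inv.
- rewrite !mulmxA mulmxK // -(mulmxA (invmx C)) TT GE trmx_mul !mulmxA.
  by rewrite mulVmx // mul1mx.
Qed.

Definition parseval_retract n k (t : R) (G : 'M[R]_k) (B : 'M[R]_(n, k)) :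
  'M[R]_(n, k) := B *m ((1 - t)%:M + t *: inv_sqrt_frame G B).

Lemma parseval_retract0 n k (G : 'M[R]_k) (B : 'M[R]_(n, k)) :
  parseval_retract 0 G B = B.
Proof. by rewrite /parseval_retract subr0 scale0r addr0 mulmx1. Qed.

(** [G *m (B^T *m B) = 1%:M] is the Parseval condition in coordinates; under it the identity meets
    the characterization of [T]. *)
Lemma parseval_retract_id n k t (G : 'M[R]_k) (B : 'M[R]_(n, k)) :
  posdefmx G -> G *m (B^T *m B) = 1%:M -> parseval_retract t G B = B.
Proof.
move=> Gpd GB; rewrite /parseval_retract (@inv_sqrt_frame_uniq _ _ _ 1%:M) //.
- by rewrite invmx1 scalemx1 -raddfD /= subrK mulmx1.
- by rewrite mul1mx.
- by rewrite mulmx1.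
Qed.

(** As [T] is self-adjoint for [G], so is its inverse, and the product becomes [T^-1 T^2 T^-1]. *)
Lemma parseval_retract1 n k (G : 'M[R]_k) (B : 'M[R]_(n, k)) :
    posdefmx G -> row_full B ->
  G *m ((parseval_retract 1 G B)^T *m parseval_retract 1 G B) = 1%:M.
Proof.
move=> Gpd Bfull; have [T [TGpd TT TE]] := inv_sqrt_frameP Gpd Bfull.
have Tu : T \in unitmx.
  by have := posdef_unit TGpd; rewrite unitmx_mul => /andP[].
rewrite /parseval_retract subrr raddf0 add0r scale1r TE.
have GT : G *m (invmx T)^T = invmx T *m G.
  have GT : T *m G = G *m T^T by rewrite -TGpd.1 trmx_mul Gpd.1.
  apply: (can_inj (mulKmx Tu)); rewrite mulmxA GT -mulmxA -trmx_mul.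
  by rewrite mulVmx // trmx1 mulmx1 mulKVmx.
rewrite trmx_mul !mulmxA GT -(mulmxA _ G) -(mulmxA _ (G *m _)).
rewrite -[G *m _ *m _]mulmxA.
by rewrite -TT !mulmxA mulVmx // mul1mx mulmxV.
Qed.

(** Conjugation by [W] turns the right factor into a convex combination of the identity and
    [invmx N], which is positive definite and so invertible. *)
Lemma parseval_retract_full n k t (G : 'M[R]_k) (B : 'M[R]_(n, k)) :
    0 <= t <= 1 -> posdefmx G -> row_full B ->
  row_full (parseval_retract t G B).
Proof.
move=> t01 Gpd Bfull.
have [Wpd _] := sqrtmxP Gpd; have Wu := posdef_unit Wpd.
have [Npd _] := sqrtmxP (gram_normalized_posdef Gpd Bfull).
rewrite /parseval_retract /inv_sqrt_frame.
set W := sqrtmx G in Wpd Wu *; set N := sqrtmx _ in Npd *.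
have -> : (1 - t)%:M + t *: (W *m invmx N *m invmx W) =
    W *m ((1 - t)%:M + t *: invmx N) *m invmx W.
  rewrite mulmxDr mulmxDl -scalemxAr -scalemxAl; congr (_ + _).
  by rewrite mul_mx_scalar -scalemxAl mulmxV // scalemx1.
have Uu := posdef_unit (posdef_convex t01 (posdef_inv Npd)).
have {Uu} Uu : W *m ((1 - t)%:M + t *: invmx N) *m invmx W \in unitmx.
  by rewrite !unitmx_mul unitmx_inv Wu Uu.
move: (W *m _ *m _) Uu => U Uu; have /row_fullP[D DB] := Bfull.
apply/row_fullP; exists (invmx U *m D).
by rewrite -mulmxA (mulmxA D) DB mul1mx mulVmx.
Qed.

Lemma parseval_retract_congr n k t (G G' C : 'M[R]_k) (B : 'M[R]_(n, k)) :
    C \in unitmx -> posdefmx G' -> row_full B -> G = C *m G' *m C^T ->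
  parseval_retract t G' (B *m C) = parseval_retract t G B *m C.
Proof.
move=> Cu G'pd Bfull GE; rewrite /parseval_retract -!mulmxA; congr (_ *m _).
rewrite mulmxDr mulmxDl mul_mx_scalar mul_scalar_mx -scalemxAr -scalemxAl.
by rewrite (inv_sqrt_frame_congr Cu G'pd Bfull GE).
Qed.

End ParsevalMatrix.

(** * Continuity of matrix operations along an arbitrary filter *)

Section MatrixLimits.
Variables (R : realType) (T : Type) (F : set_system T).
Context {FF : Filter F}.

Lemma cvg_mx m n (f : T -> 'M[R]_(m, n)) (A : 'M[R]_(m, n)) :
  (forall i j, f x i j @[x --> F] --> A i j) -> f @ F --> A.
Proof.
move=> fA U [P AP PU]; rewrite /nbhs /=.
apply: (@filterS _ F _ (fun x => forall i j, P i j (f x i j))).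
  by move=> x Pfx; exact: PU.
apply: filter_forall => i; apply: filter_forall => j.
exact: fA (AP i j).
Qed.

Lemma cvg_mx_entry m n (f : T -> 'M[R]_(m, n)) (A : 'M[R]_(m, n)) i j :
  f @ F --> A -> f x i j @[x --> F] --> A i j.
Proof.
move=> fA; apply: (cvg_comp f (fun M : 'M[R]_(m, n) => M i j) fA).
exact: coord_continuous.
Qed.

Lemma cvg_rsum (I : Type) (r : seq I) (P : pred I) (f : I -> T -> R)
    (a : I -> R) :
  (forall i, f i @ F --> a i) ->
  \sum_(i <- r | P i) f i x @[x --> F] --> \sum_(i <- r | P i) a i.
Proof. by move=> fa; apply: cvg_big => //; exact: add_continuous. Qed.

Lemma cvg_rprod (I : Type) (r : seq I) (P : pred I) (f : I -> T -> R)
    (a : I -> R) :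
  (forall i, f i @ F --> a i) ->
  \prod_(i <- r | P i) f i x @[x --> F] --> \prod_(i <- r | P i) a i.
Proof. by move=> fa; apply: cvg_big => //; exact: mul_continuous. Qed.

Lemma cvg_mulmx m n p (f : T -> 'M[R]_(m, n)) (g : T -> 'M[R]_(n, p))
    (A : 'M[R]_(m, n)) (B : 'M[R]_(n, p)) :
  f @ F --> A -> g @ F --> B -> f x *m g x @[x --> F] --> A *m B.
Proof.
move=> fA gB; apply: cvg_mx => i j; rewrite mxE.
under eq_fun do rewrite mxE.
by apply: cvg_rsum => l; apply: cvgM; exact: cvg_mx_entry.
Qed.

Lemma cvg_trmx m n (f : T -> 'M[R]_(m, n)) (A : 'M[R]_(m, n)) :
  f @ F --> A -> (f x)^T @[x --> F] --> A^T.
Proof.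
move=> fA; apply: cvg_mx => i j; rewrite mxE.
by under eq_fun do rewrite mxE; exact: cvg_mx_entry.
Qed.

Lemma cvg_scalar_mx n (f : T -> R) (a : R) :
  f @ F --> a -> (f x)%:M @[x --> F] --> (a%:M : 'M[R]_n).
Proof.
move=> fa; apply: cvg_mx => i j; rewrite mxE.
by under eq_fun do rewrite mxE; exact: cvgMn.
Qed.

Lemma cvg_mxtrace n (f : T -> 'M[R]_n) (A : 'M[R]_n) :
  f @ F --> A -> \tr (f x) @[x --> F] --> \tr A.
Proof. by move=> fA; apply: cvg_rsum => i; exact: cvg_mx_entry. Qed.

Lemma cvg_det n (f : T -> 'M[R]_n) (A : 'M[R]_n) :
  f @ F --> A -> \det (f x) @[x --> F] --> \det A.
Proof.
move=> fA; apply: cvg_rsum => s; apply: cvgM; first exact: cvg_cst.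
by apply: cvg_rprod => i; exact: cvg_mx_entry.
Qed.

Lemma cvg_adj n (f : T -> 'M[R]_n) (A : 'M[R]_n) :
  f @ F --> A -> \adj (f x) @[x --> F] --> \adj A.
Proof.
move=> fA; apply: cvg_mx => i j; rewrite mxE.
under eq_fun do rewrite mxE.
apply: cvgM; first exact: cvg_cst.
apply: cvg_det; apply: cvg_mx => i' j'; rewrite !mxE.
by under eq_fun do rewrite !mxE; exact: cvg_mx_entry.
Qed.

Lemma cvg_invmx n (f : T -> 'M[R]_n) (A : 'M[R]_n) : A \in unitmx ->
  f @ F --> A -> invmx (f x) @[x --> F] --> invmx A.
Proof.
rewrite unitmxE unitfE => A0 fA.
have -> : invmx A = (\det A)^-1 *: \adj A by rewrite /invmx unitmxE unitfE A0.
(* The cofactor formula for [invmx] is available where the determinant is nonzero, which is the case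
   near the limit. *)
have f0 : \forall x \near F, \det (f x) != 0.
  apply: (cvgr_neq0 (\det A)) => //; exact: cvg_det.
apply: cvg_trans; last first.
  exact: (cvgZ (cvgV A0 (cvg_det fA)) (cvg_adj fA)).
apply: near_eq_cvg; apply: filterS f0 => x fx.
by rewrite /invmx unitmxE unitfE fx.
Qed.

(** The square of each entry of the difference of the roots is at most [K] times the squared norm of
    [S - f x], with [K] depending on [S] only. *)
Lemma cvg_sqrtmx n (f : T -> 'M[R]_n) (S : 'M[R]_n) : posdefmx S ->
    (\forall x \near F, posdefmx (f x)) ->
  f @ F --> S -> sqrtmx (f x) @[x --> F] --> sqrtmx S.
Proof.
move=> /sqrtmxP[Ppd PP] fpd fS.
have [K K0 lip] := posdef_sqrt_lipschitz Ppd; rewrite PP in lip.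
set P := sqrtmx S in Ppd PP lip *.
have lim0 : K * \tr ((S - f x) *m (S - f x)^T) @[x --> F] --> (0 : R).
  have -> : 0 = K * \tr ((S - S) *m (S - S)^T).
    by rewrite subrr mul0mx mxtrace0 mulr0.
  have SfS : S - f x @[x --> F] --> S - S by apply: cvgB => //; exact: cvg_cst.
  apply: cvgM; first exact: cvg_cst.
  by apply: cvg_mxtrace; apply: (cvg_mulmx SfS); exact: cvg_trmx.
apply: cvg_mx => i j; apply/cvgrPdist_lt => e e0.
have : \forall x \near F, K * \tr ((S - f x) *m (S - f x)^T) < e ^+ 2.
  by apply: cvgr_lt lim0 _ _; exact: exprn_gt0.
apply: filterS2 fpd => x fxpd lt_e.
have [Qpd QQ] := sqrtmxP fxpd.
rewrite -(ltr_pXn2r (n := 2)) ?nnegrE ?normr_ge0 ?ltW //.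
rewrite real_normK ?num_real //.
apply: le_lt_trans lt_e; rewrite -{2 3}QQ.
apply: le_trans (lip _ Qpd); apply: le_trans (sqr_entry_le_mxtrace _ i j).
by rewrite !mxE.
Qed.

Lemma cvg_parseval_retract n k (t : T -> R) (G : T -> 'M[R]_k)
    (B : T -> 'M[R]_(n, k)) (t0 : R) (G0 : 'M[R]_k) (B0 : 'M[R]_(n, k)) :
    posdefmx G0 -> row_full B0 ->
    (\forall x \near F, posdefmx (G x)) ->
    (\forall x \near F, row_full (B x)) ->
    t @ F --> t0 -> G @ F --> G0 -> B @ F --> B0 ->
  parseval_retract (t x) (G x) (B x) @[x --> F] --> parseval_retract t0 G0 B0.
Proof.
move=> G0pd B0full Gpd Bfull tt0 GG0 BB0.
have WW := cvg_sqrtmx G0pd Gpd GG0.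
have N0pd := gram_normalized_posdef G0pd B0full.
have NN : gram_normalized (G x) (B x) @[x --> F] --> gram_normalized G0 B0.
  apply: (cvg_mulmx _ WW); apply: (cvg_mulmx WW).
  by apply: (cvg_mulmx _ BB0); exact: cvg_trmx.
have Npd : \forall x \near F, posdefmx (gram_normalized (G x) (B x)).
  by apply: filterS2 Gpd Bfull => x; exact: gram_normalized_posdef.
have W0u : sqrtmx G0 \in unitmx by apply: posdef_unit; have [] := sqrtmxP G0pd.
have N0u : sqrtmx (gram_normalized G0 B0) \in unitmx.
  by apply: posdef_unit; have [] := sqrtmxP N0pd.
apply: (cvg_mulmx BB0); apply: cvgD.
  by apply: cvg_scalar_mx; apply: cvgB => //; exact: cvg_cst.
apply: cvgZ => //; apply: cvg_mulmx; last exact: cvg_invmx.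
by apply: cvg_mulmx => //; apply: cvg_invmx => //; exact: cvg_sqrtmx.
Qed.

End MatrixLimits.

(** * Coordinates in local trivializations *)

Section Coordinates.
Variables (R : realType) (m : nat) (M : manifold R m) (k : nat).
Variables (E : vector_bundle M k).
Implicit Types (a b : bundle_chart E k) (p : M).

Lemma bc_funK a p : bc_dom a p -> cancel (bc_fun a p) (bc_fun a p)^-1%VF.
Proof. by move=> ap; apply/lker0_lfunK/eqP/bc_inj. Qed.

Lemma bc_invK a p : bc_dom a p -> cancel (bc_fun a p)^-1%VF (bc_fun a p).
Proof. by move=> ap u; apply: limg_lfunVK; rewrite bc_surj ?memvf. Qed.

Lemma mul_transition a b p (u : 'rV[R]_k) :
  u *m transition a b p = bc_fun b p ((bc_fun a p)^-1%VF u).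
Proof. by rewrite /transition mul_rV_lin1 /= comp_lfunE. Qed.

Lemma transition_unit a b p : bc_dom a p -> bc_dom b p ->
  transition a b p \in unitmx.
Proof.
move=> ap bp; have tt : transition a b p *m transition b a p = 1%:M.
  apply/row_matrixP => i.
  by rewrite !rowE mulmxA !mul_transition bc_funK // bc_invK // mulmx1.
by have [] := mulmx1_unit tt.
Qed.

Lemma dot_gram_mx (V : vectType R) (d : {dot V for (@idfun R)})
    (f : 'Hom('rV[R]_k, V)) (u v : 'rV[R]_k) :
  d (f u) (f v) =
  (u *m (\matrix_(i, j) d (f (delta_mx 0 i)) (f (delta_mx 0 j))) *m v^T) 0 0.
Proof.
rewrite {1}[u]row_sum_delta linear_sum linear_sumlz -mulmxA mxE.
apply: eq_bigr => i _; rewrite linearZ linearZl_LR /=; congr (_ * _).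
rewrite {1}[v]row_sum_delta linear_sum linear_sumr mxE.
by apply: eq_bigr => j _; rewrite linearZ linearZr_LR /= !mxE mulrC.
Qed.

Variable g : riemannian E.

Definition gram a p : 'M[R]_k :=
  \matrix_(i, j) rm_dot g p ((bc_fun a p)^-1%VF (delta_mx 0 i))
                            ((bc_fun a p)^-1%VF (delta_mx 0 j)).

Lemma gramE a p (u v : 'rV[R]_k) :
  rm_dot g p ((bc_fun a p)^-1%VF u) ((bc_fun a p)^-1%VF v) =
  (u *m gram a p *m v^T) 0 0.
Proof. exact: dot_gram_mx. Qed.

Lemma gram_posdef a p : bc_dom a p -> posdefmx (gram a p).
Proof.
move=> ap; split=> [|v v0].
  by apply/matrixP => i j; rewrite !mxE hermC expr0 mul1r.
rewrite -gramE; apply: neq0_dnorm_gt0; apply: contra v0 => /eqP v0.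
by rewrite -[v](bc_invK ap) v0 linear0.
Qed.

Lemma gram_congr a b p : bc_dom a p -> bc_dom b p ->
  gram a p = transition a b p *m gram b p *m (transition a b p)^T.
Proof.
move=> ap bp; apply/matrixP => i j.
have entry (S : 'M[R]_k) : S i j =
      ((delta_mx 0 i : 'rV_k) *m S *m (delta_mx 0 j : 'rV_k)^T) 0 0.
  by rewrite -rowE trmx_delta -colE !mxE.
rewrite entry -gramE [RHS]entry !mulmxA -mulmxA -trmx_mul !mul_transition.
by rewrite -gramE !bc_funK.
Qed.

Variable n : nat.
Implicit Types x : hom_bundle E n.

(** Over [bc_dom a] this is the matrix component of the inverse of [hom_chart_inv a]. *)
Definition hom_coord a x : 'M[R]_(n, k) :=
  lin1_mx (bc_fun a (hom_base x) \o hom_map x)%VF.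

Lemma mul_hom_coord a x (u : 'rV[R]_n) :
  u *m hom_coord a x = bc_fun a (hom_base x) (hom_map x u).
Proof. by rewrite /hom_coord mul_rV_lin1 /= comp_lfunE. Qed.

Lemma hom_mapE a x (u : 'rV[R]_n) : bc_dom a (hom_base x) ->
  hom_map x u = (bc_fun a (hom_base x))^-1%VF (u *m hom_coord a x).
Proof. by move=> ax; rewrite mul_hom_coord bc_funK. Qed.

Lemma hom_coord_inv a (pB : M * 'M[R]_(n, k)) : bc_dom a pB.1 ->
  hom_coord a (hom_chart_inv a pB) = pB.2.
Proof.
move=> ap; apply/row_matrixP => i; rewrite !rowE mul_hom_coord /=.
by rewrite comp_lfunE bc_invK // lfunE.
Qed.

Lemma hom_coordK a x : bc_dom a (hom_base x) ->
  hom_chart_inv a (hom_base x, hom_coord a x) = x.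
Proof.
case: x => p A /= ap; congr HomPoint; apply/lfunP => u.
by rewrite comp_lfunE lfunE /= mul_hom_coord bc_funK.
Qed.

Lemma hom_coord_transition a b x : bc_dom a (hom_base x) ->
  hom_coord b x = hom_coord a x *m transition a b (hom_base x).
Proof.
move=> ax; apply/row_matrixP => i.
by rewrite !rowE mulmxA mul_transition !mul_hom_coord bc_funK.
Qed.

Lemma hom_chart_inv_transition a b p (B : 'M[R]_(n, k)) :
    bc_dom a p -> bc_dom b p ->
  hom_chart_inv b (p, B *m transition a b p) = hom_chart_inv a (p, B).
Proof.
move=> ap bp; congr HomPoint; apply/lfunP => u.
by rewrite !comp_lfunE !lfunE /= mulmxA mul_transition bc_funK.
Qed.

Lemma frame_coord a x : bc_dom a (hom_base x) ->
  frame_bundle E n x <-> row_full (hom_coord a x).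
Proof.
move=> ax; split=> [xfull|/row_fullP[D DB]].
  apply/row_fullP.
  (* The pseudo-inverse of the surjective [hom_map x] is a right inverse; on row vectors composition
     is reversed, so its matrix is a left inverse. *)
  exists (lin1_mx ((hom_map x)^-1 \o (bc_fun a (hom_base x))^-1)%VF).
  apply/row_matrixP => i; rewrite !rowE mulmxA mul_hom_coord mul_rV_lin1 /=.
  by rewrite comp_lfunE limg_lfunVK ?xfull ?memvf // bc_invK // mulmx1.
apply/vspaceP => v; rewrite memvf -[v](bc_funK ax) -[bc_fun _ _ _]mulmx1.
rewrite -DB mulmxA.
by rewrite -hom_mapE // memv_img ?memvf.
Qed.

(** In coordinates the adjoint of [hom_map x] sends [v] to [bc_fun a p v *m G *m B^T], so that
    [A A^T] is right multiplication by [G *m B^T *m B]. *)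
Lemma parseval_coord a x : bc_dom a (hom_base x) -> frame_bundle E n x ->
  parseval_bundle g n x <->
  gram a (hom_base x) *m ((hom_coord a x)^T *m hom_coord a x) = 1%:M.
Proof.
set p := hom_base x; set G := gram a p; set B := hom_coord a x.
move=> ap xfull; have [Gsym _] := gram_posdef ap.
have dotE u v : rm_dot g p (hom_map x u) v =
    (u *m (bc_fun a p v *m G *m B^T)^T) 0 0.
  rewrite (hom_mapE _ ap) -[v in LHS](bc_funK ap) gramE.
  by rewrite !trmx_mul trmxK Gsym !mulmxA.
split=> [[_ [A' adj AA']]|GB].
  have A'E v : A' v = bc_fun a p v *m G *m B^T.
    apply/rowP => i; have := adj (delta_mx 0 i) v; rewrite dotE -rowE.
    rewrite mxE [X in X = _]mxE => ->; rewrite (bigD1 i) //= big1 ?addr0.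
      by rewrite mxE !eqxx mul1r.
    by move=> j ji; rewrite mxE (negPf ji) andbF mul0r.
  apply/row_matrixP => i; rewrite !rowE mulmx1.
  move/lfunP/(_ ((bc_fun a p)^-1%VF (delta_mx 0 i))): AA'.
  rewrite comp_lfunE id_lfunE A'E bc_invK // => /(congr1 (bc_fun a p)).
  by rewrite -mul_hom_coord bc_invK // !mulmxA.
split=> //; exists (linfun (mulmxr (G *m B^T)) \o bc_fun a p)%VF.
  move=> u v; rewrite dotE comp_lfunE lfunE /= mxE mulmxA.
  by apply: eq_bigr => i _; rewrite [(_^T) _ _]mxE.
apply/lfunP => v; rewrite !comp_lfunE id_lfunE lfunE /= (hom_mapE _ ap).
by rewrite -mulmxA -[X in _ *m X]mulmxA GB mulmx1 bc_funK.
Qed.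

End Coordinates.

(** * Continuity of smooth functions and the topology of the bundle of homomorphisms *)

Lemma smooth_fun_continuous (R : realType) (m : nat) (M : manifold R m)
    (U : set M) (f : M -> R) (p : M) :
  open U -> U p -> smooth_fun U f -> {for p, continuous f}.
Proof.
move=> oU Up fsm; have [c Ac cp] := mf_atlas_cover p.
have cfun_p : chart_fun c @ p --> chart_fun c p.
  have := @chart_fun_continuous _ _ _ c.
  rewrite continuous_open_subspace; last exact: chart_dom_open.
  by apply; exact/mem_set.
have [fc _] := fsm c Ac 0%N.
set V := chart_fun c @` _ in fc.
have Vp : V (chart_fun c p) by exists p.
have {}fc : f \o chart_inv c @ within V (nbhs (chart_fun c p)) --> f p.
  move=> W fW; have := fc (chart_fun c p) W.
  rewrite /continuous_at /from_subspace /= chart_funK // => /(_ fW).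
  by rewrite /nbhs /= -nbhs_subspace_in.
move=> W /fc /cfun_p WV; rewrite /nbhs /=.
(* Near [p] the chart takes its values in [V], where the relative limit [fc] applies. *)
have cU : \forall q \near p, chart_dom c q /\ U q.
  by apply: filterI; [exact: open_nbhs_nbhs (conj (chart_dom_open c) cp) |
    exact: open_nbhs_nbhs (conj oU Up)].
apply: filterS2 cU WV => q [cq Uq] /= /(_ _)/=; rewrite chart_funK //; apply.
by exists q.
Qed.

Section HomTopology.
Variables (R : realType) (m : nat) (M : manifold R m) (k : nat).
Variables (E : vector_bundle M k) (n : nat).
Implicit Types (a b : bundle_chart E k) (p : M) (x : hom_bundle E n).

Lemma bc_dom_near a p : bc_dom a p -> \forall q \near p, bc_dom a q.
Proof. by move=> ap; exact: open_nbhs_nbhs (conj (bc_dom_open a) ap). Qed.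

Lemma transition_continuous a b p : vb_atlas a -> vb_atlas b ->
  bc_dom a p -> bc_dom b p -> {for p, continuous (transition a b)}.
Proof.
move=> Aa Ab ap bp; apply: cvg_mx => i j.
apply: (smooth_fun_continuous _ _ (vb_atlas_smooth Aa Ab i j)) => //.
by apply: openI; exact: bc_dom_open.
Qed.

Lemma gram_continuous (g : riemannian E) a p : vb_atlas a -> bc_dom a p ->
  {for p, continuous (gram g a)}.
Proof.
move=> Aa ap; apply: cvg_mx => i j; rewrite mxE.
under eq_fun do rewrite mxE.
exact: (smooth_fun_continuous (bc_dom_open a) ap (rm_smooth g Aa i j)).
Qed.

Lemma hom_chart_inv_continuous a (pB : M * 'M[R]_(n, k)) :
  vb_atlas a -> bc_dom a pB.1 ->
  {for pB, continuous (@hom_chart_inv _ _ _ _ E n a)}.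
Proof.
move=> Aa ap W; rewrite nbhsE /= => -[W' [oW' W'x] sW].
rewrite /nbhs /=; apply: filterS (open_nbhs_nbhs (conj (oW' a Aa) _)).
  by move=> qC /= [_ /sW].
by split.
Qed.

(** Openness is tested in each trivialization [b] of the atlas, where the map sends [(q, C)] to
    [(q, C *m transition b a q)]; transitions are continuous. *)
Lemma hom_coord_continuous a x : vb_atlas a -> bc_dom a (hom_base x) ->
  {for x, continuous (fun y => (hom_base y, hom_coord a y))}.
Proof.
move=> Aa ax U; rewrite nbhsE /= => -[U' [oU' U'x] sU].
pose W := [set y | bc_dom a (hom_base y) /\ U' (hom_base y, hom_coord a y)].
have oW : open W.
  move=> b Ab; rewrite openE => -[q C] /= [[bq _] [/= aq]].
  rewrite -(hom_chart_inv_transition _ bq aq) hom_coord_inv //= => U'q.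
  have fq : (fst : M * 'M[R]_(n, k) -> M) @ (q, C) --> q by exact: cvg_fst.
  have tq : transition b a qC.1 @[qC --> (q, C)] --> transition b a q.
    by apply: (cvg_comp fst (transition b a) fq); exact: transition_continuous.
  have Cq : qC.2 *m transition b a qC.1
      @[qC --> (q, C)] --> C *m transition b a q.
    by apply: cvg_mulmx tq; exact: cvg_snd.
  have trq : (qC.1, qC.2 *m transition b a qC.1)
      @[qC --> (q, C)] --> (q, C *m transition b a q).
    exact: (cvg_pair fq Cq).
  have nU : \forall qC \near (q, C), U' (qC.1, qC.2 *m transition b a qC.1).
    by apply: trq; exact: open_nbhs_nbhs.
  have nb : \forall qC \near (q, C), bc_dom b qC.1.
    exact: fq (bc_dom_near bq).
  have na : \forall qC \near (q, C), bc_dom a qC.1.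
    exact: fq (bc_dom_near aq).
  rewrite /interior /=; apply: filterS3 nb na nU => -[q' C'] /= bq' aq' U'q'.
  split; first by split.
  split => //=.
  by rewrite -(hom_chart_inv_transition _ bq' aq') hom_coord_inv.
rewrite /nbhs /=; apply: filterS (open_nbhs_nbhs (conj oW _)); last by split.
by move=> y [_ /sU].
Qed.

Lemma hom_base_continuous : continuous (@hom_base _ _ _ _ E n).
Proof.
move=> x; have [a Aa ax] := vb_atlas_cover E (hom_base x).
apply: (cvg_comp _ fst (hom_coord_continuous Aa ax)); exact: cvg_fst.
Qed.

End HomTopology.

(** * The retraction on the bundle *)

Section Retraction.
Variables (R : realType) (m : nat) (M : manifold R m) (k : nat).
Variables (E : vector_bundle M k) (g : riemannian E) (n : nat).
Implicit Types (a b : bundle_chart E k) (p : M) (x : hom_bundle E n).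

Definition chart_retract a (t : R) x : hom_bundle E n :=
  hom_chart_inv a
    (hom_base x, parseval_retract t (gram g a (hom_base x)) (hom_coord a x)).

(** A trivialization is chosen separately over each point of [M]; by [hom_retractE] the result does
    not depend on this choice on frames. *)
Definition hom_retract (t : R) x : hom_bundle E n :=
  chart_retract (sval (cid2 (vb_atlas_cover E (hom_base x)))) t x.

(** The two trivializations agree by [parseval_retract_congr], with the transition matrix as change
    of basis. *)
Lemma hom_retractE a t x : bc_dom a (hom_base x) -> frame_bundle E n x ->
  hom_retract t x = chart_retract a t x.
Proof.
move=> ax xfull; rewrite /hom_retract; case: cid2 => b Ab bx /=.
rewrite /chart_retract (hom_coord_transition b ax).
have Bfull := (frame_coord ax).1 xfull.
have GE := gram_congr g ax bx.
rewrite (parseval_retract_congr _ _ (gram_posdef g bx) Bfull GE).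
  exact: hom_chart_inv_transition.
exact: transition_unit.
Qed.

Lemma hom_coord_retract a t x : bc_dom a (hom_base x) -> frame_bundle E n x ->
  hom_coord a (hom_retract t x) =
  parseval_retract t (gram g a (hom_base x)) (hom_coord a x).
Proof. by move=> ax xfull; rewrite (hom_retractE _ ax) // hom_coord_inv. Qed.

Lemma hom_retract_frame t x : 0 <= t <= 1 -> frame_bundle E n x ->
  frame_bundle E n (hom_retract t x).
Proof.
move=> t01 xfull; have [a _ ax] := vb_atlas_cover E (hom_base x).
apply/(@frame_coord _ _ _ _ _ _ a) => //; rewrite hom_coord_retract //.
apply: parseval_retract_full => //; first exact: gram_posdef.
exact/frame_coord.
Qed.

Lemma hom_retract0 x : frame_bundle E n x -> hom_retract 0 x = x.
Proof.
move=> xfull; have [a _ ax] := vb_atlas_cover E (hom_base x).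
by rewrite (hom_retractE _ ax) // /chart_retract parseval_retract0 hom_coordK.
Qed.

Lemma hom_retract1 x : frame_bundle E n x ->
  parseval_bundle g n (hom_retract 1 x).
Proof.
move=> xfull; have [a _ ax] := vb_atlas_cover E (hom_base x).
apply/(@parseval_coord _ _ _ _ _ _ _ a) => //.
  by apply: hom_retract_frame => //; rewrite ler01 lexx.
rewrite hom_coord_retract //; apply: parseval_retract1.
  exact: gram_posdef.
exact/frame_coord.
Qed.

Lemma hom_retract_id t x : parseval_bundle g n x -> hom_retract t x = x.
Proof.
move=> xpars; have xfull := xpars.1.
have [a _ ax] := vb_atlas_cover E (hom_base x).
rewrite (hom_retractE _ ax) // /chart_retract parseval_retract_id.
- exact: hom_coordK.
- exact: gram_posdef.
- exact/parseval_coord.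
Qed.

(** One trivialization around the base point of the limit [x] serves eventually along [F], and in it
    the retraction is a composite of continuous matrix operations. *)
Lemma hom_retract_cvg (T : Type) (F : set_system T) (FF : Filter F)
    (f : T -> hom_bundle E n) (t : T -> R) x t0 :
    frame_bundle E n x -> (forall z, frame_bundle E n (f z)) ->
    f @ F --> x -> t @ F --> t0 ->
  hom_retract (t z) (f z) @[z --> F] --> hom_retract t0 x.
Proof.
move=> xfull ffull fx tt0.
have [a Aa ax] := vb_atlas_cover E (hom_base x).
have fa : \forall z \near F, bc_dom a (hom_base (f z)).
  exact: fx _ (hom_base_continuous (bc_dom_near ax)).
rewrite (hom_retractE t0 ax xfull).
apply: cvg_trans.
  apply: near_eq_cvg; apply: filterS fa => z faz.
  exact: esym (hom_retractE (t z) faz (ffull z)).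
rewrite /chart_retract.
apply: (cvg_comp _ (hom_chart_inv a) _ (hom_chart_inv_continuous Aa _)) => //.
have bx : hom_base (f z) @[z --> F] --> hom_base x.
  by apply: (cvg_comp f _ fx); exact: hom_base_continuous.
have cx : hom_coord a (f z) @[z --> F] --> hom_coord a x.
  apply: (cvg_comp f (hom_coord a) fx).
  by apply: (cvg_comp _ snd (hom_coord_continuous Aa ax)); exact: cvg_snd.
suff rx : parseval_retract (t z) (gram g a (hom_base (f z))) (hom_coord a (f z))
    @[z --> F] --> parseval_retract t0 (gram g a (hom_base x)) (hom_coord a x).
  exact: (cvg_pair bx rx).
apply: cvg_parseval_retract => //.
- exact: gram_posdef.
- exact/frame_coord.
- by apply: filterS fa => z; exact: gram_posdef.
- by apply: filterS fa => z faz; exact/(frame_coord faz).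
- by apply: (cvg_comp _ (gram g a) bx); exact: gram_continuous.
Qed.

End Retraction.

Theorem theorem3p7 (R : realType) (m : nat) (M : manifold R m) (k : nat)
    (E : vector_bundle M k) (hE : orientable E) (g : riemannian E)
    (n : nat) (hkn : (k <= n)%N) :
  exists H : frame_bundle E n * `[0, 1 : R]%classic -> frame_bundle E n,
    [/\ continuous H,
        forall (x : frame_bundle E n) (t : `[0, 1 : R]%classic),
          set_val t = 0 -> H (x, t) = x,
        forall (x : frame_bundle E n) (t : `[0, 1 : R]%classic),
          set_val t = 1 -> parseval_bundle g n (set_val (H (x, t))),
        forall (y : frame_bundle E n) (t : `[0, 1 : R]%classic),
          parseval_bundle g n (set_val y) -> H (y, t) = y &
        forall (x : frame_bundle E n) (t : `[0, 1 : R]%classic),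
          frame_proj (H (x, t)) = frame_proj x].
Proof.
have full (x : frame_bundle E n) : frame_bundle E n (set_val x).
  exact: set_valP.
have unit_itv (t : `[0, 1 : R]%classic) : 0 <= set_val t <= 1.
  by have := set_valP t; rewrite /= in_itv.
pose H (z : frame_bundle E n * `[0, 1 : R]%classic) : frame_bundle E n :=
  exist _ (hom_retract g (set_val z.2) (set_val z.1))
    (mem_set (hom_retract_frame g (unit_itv z.2) (full z.1))).
have HE x t : set_val (H (x, t)) = hom_retract g (set_val t) (set_val x) by [].
exists H; split.
(* The space of frames has the initial topology for [set_val], so continuity is checked in
   [hom_bundle E n]. *)
- apply: continuous_comp_initial => -[x t].
  apply: hom_retract_cvg => //.
  + apply: (cvg_comp fst set_val); first exact: cvg_fst.
    exact: initial_continuous.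
  + apply: (cvg_comp snd set_val); first exact: cvg_snd.
    exact: initial_continuous.
- by move=> x t t0; apply: val_inj; rewrite [LHS]HE t0 hom_retract0.
- by move=> x t t1; rewrite HE t1; exact: hom_retract1.
- by move=> x t xpars; apply: val_inj; rewrite [LHS]HE hom_retract_id.
- by [].
Qed.
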